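(* Let $n\ge 1$ and $m\ge 1$ be any positive integers with $m\le n$. Then for any prime $p$, $$\binom{np}{mp}\equiv\binom{n}{m}\pmod{p}.$$ *)

(* Defs.v *)
From mathcomp Require Import all_boot.

(* Main.v *)
Require Import Defs.
From mathcomp Require Import all_boot.

(* Pascal's rule with step p, i.e. the congruence
   (1 + X)^(p + N) = (1 + X^p) (1 + X)^N modulo p read off at X^(M + p); iterating
   it on multiples of p gives the theorem by the recursion defining 'C(n, m). *)

Lemma bin_addp_mod (p N M : nat) : prime p ->
  'C(p + N, M + p) = 'C(N, M + p) + 'C(N, M) %[mod p].
Proof.
move=> pr_p; have p_gt0 := prime_gt0 pr_p.
have lt_p : p < (M + p).+1 by rewrite ltnS leq_addl.
(* Vandermonde sums ['C(p, i) * 'C(N, M + p - i)] over [i <= M + p]; the terms [i = 0] and [i = p]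
   are the two on the right. *)
rewrite -Vandermonde (bigD1 ord0) //= (bigD1 (Ordinal lt_p)) /=; last first.
  by rewrite -val_eqE /= -lt0n.
rewrite bin0 binn !mul1n subn0 addnK addnA.
set r := bigop _ _ _; suffices /eqP r_mod0 : p %| r by rewrite -modnDmr r_mod0 addn0.
apply: dvdn_sum => i /andP[]; rewrite -!val_eqE /= => i_neq0 i_neqp.
(* ['C(p, i)] vanishes for [i > p], and the prime [p] divides it for [0 < i < p]. *)
have [lt_pi | le_ip] := ltnP p i; first by rewrite bin_small.
by rewrite dvdn_mulr // prime_dvd_bin // lt0n i_neq0 ltn_neqAle i_neqp.
Qed.

(** Pascal's rule leads from [1 <= m <= n] to [m = 0] and [m > n], so the induction on [n] takes
    every [m]. *)
Lemma bin_mulp_mod (p n m : nat) : prime p ->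
  'C(n * p, m * p) = 'C(n, m) %[mod p].
Proof.
move=> pr_p; elim: n m => [|n IHn] [|m]; rewrite ?mul0n ?bin0 //.
  by rewrite !bin0n muln_eq0 (gtn_eqF (prime_gt0 pr_p)).
(* Both sides split alike, into entries of row [n] at [m.+1] and [m]. *)
rewrite mulSn mulSnr bin_addp_mod // -mulSnr binS.
by rewrite -modnDm !IHn modnDm.
Qed.

Theorem corollary4 (n m : nat) (hn : 1 <= n) (hm : 1 <= m) (hmn : m <= n)
    (p : nat) (hp : prime p) :
  'C(n * p, m * p) = 'C(n, m) %[mod p].
Proof. exact: bin_mulp_mod. Qed.
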